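(* For any regular oriented matroid $N=(A,\mathfrak{C})$, \[|\Omega_N^\geq|=\#\{[{}_{-S}N] : S\subseteq A\text{ cocycle of }\underline N\},\] and \[|\Omega_N^>|=\#\{[{}_{-S}N] : S\subseteq A\text{ cocycle of }\underline N\text{ such that }{}_{-S}N\text{ is acyclic}\}.\]
   Context: An oriented matroid $N=(A,\mathfrak{C})$ has signed circuits $C=(C^+,C^-)$; it is regular if representable over $\mathbb{R}$ by a totally unimodular matrix; $\underline N$ is the underlying matroid. For a signed circuit $C$, $\overline C\in\{-1,0,1\}^A$ is its signed incidence vector ($1$ on $C^+$, $-1$ on $C^-$, $0$ elsewhere), and $\langle\cdot,\cdot\rangle$ is the standard inner product on $\mathbb{R}^A$. Let $\Pi_N=\{x\in\mathbb{R}^A: 0\le x_a\le 1/2\ \forall a,\ \langle\overline C,x\rangle\in\mathbb{Z}\ \forall C\in\mathfrak{C}\}$ and $\Pi_N^>=\{x\in\mathbb{R}^A: 0<x_a<1/2\ \forall a,\ \langle\overline C,x\rangle\in\mathbb{Z}\ \forall C\in\mathfrak{C}\}$. For $x\in\Pi_N$, $\alpha_x:\mathfrak{C}\to\mathbb{Z}$ is $\alpha_x(C)=\langle\overline C,x\rangle$. Set $\Omega_N^\geq=\{\alpha_x: x\in\Pi_N\}$ and $\Omega_N^>=\{\alpha_x: x\in\Pi_N^>\}$. ${}_{-S}N$ denotes reorientation of $N$ on $S$ (signs of elements of $S$ flipped in every signed circuit). A cocycle of $\underline N$ is a disjoint union of cocircuits of $\underline N$ (the empty set included). A positive cocycle of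 $N$ is a disjoint union of supports of positive cocircuits of $N$ (cocircuits with empty negative part), the empty set included. Two reorientations $N_1,N_2$ of $N$ are equivalent, $N_1\overset{+}{\sim}N_2$, if $N_2$ is obtained from $N_1$ by reorienting a positive cocycle of $N_1$; this is an equivalence relation and $[N_1]$ denotes the class of $N_1$. An oriented matroid is acyclic if it has no positive circuit (signed circuit with empty negative part). *)

(* Defs.v *)
From mathcomp Require Import all_boot all_order all_algebra.

Set Implicit Arguments.
Unset Strict Implicit.
Unset Printing Implicit Defensive.

Import Order.TTheory GRing.Theory Num.Theory.

(** * Signed sets and oriented matroids *)

(* The pair (C^+, C^-); disjointness of the two parts is not built into the
   type, it is required wherever signed sets are introduced. *)
Notation signed_set A := ({set A} * {set A})%type.

Section OrientedMatroid.
Variable A : finType.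
Implicit Types (c d X Y Z : signed_set A) (N : {set signed_set A}).
Implicit Types (S T P I J B D : {set A}) (F : {set {set A}}).

Definition supp_ss c : {set A} := c.1 :|: c.2.

Definition oppss c : signed_set A := (c.2, c.1).

(* The signed circuit axioms; [om_elim] is weak elimination. *)
Record oriented_matroid N : Prop := OrientedMatroid {
  om_disjoint : forall X, X \in N -> [disjoint X.1 & X.2];
  om_nonempty : forall X, X \in N -> supp_ss X != set0;
  om_opp : forall X, X \in N -> oppss X \in N;
  om_incomparable : forall X Y, X \in N -> Y \in N ->
    supp_ss X \subset supp_ss Y -> X = Y \/ X = oppss Y;
  om_elim : forall X Y e, X \in N -> Y \in N -> X <> oppss Y ->
    e \in X.1 :&: Y.2 ->
    exists2 Z, Z \in N &
      Z.1 \subset (X.1 :|: Y.1) :\ e /\ Z.2 \subset (X.2 :|: Y.2) :\ e }.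

Definition acyclic N : bool := [forall c in N, c.2 != set0].

(** ** Underlying matroid and its cocircuits *)

Definition underlying_circuits N : {set {set A}} := [set supp_ss c | c in N].

Definition indep F I : bool := [forall K in F, ~~ (K \subset I)].

Definition base F B : bool := maxset (indep F) B.

(* The bases of the dual matroid are the complements of the bases. *)
Definition coindep F J : bool := [exists B, base F B && (J \subset ~: B)].

Definition cocircuit F D : bool := minset (fun J => ~~ coindep F J) D.

Definition cocycle F S : bool :=
  [exists P : {set {set A}},
    [&& trivIset P, [forall D in P, cocircuit F D] & cover P == S]].

(** ** Signed cocircuits *)

(* Either the supports are disjoint, or the signs agree at some common element
   and disagree at another. *)
Definition orthogonal_ss c d : bool :=
  ((c.1 :&: d.1) :|: (c.2 :&: d.2) == set0)
    == ((c.1 :&: d.2) :|: (c.2 :&: d.1) == set0).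

(* The signed circuits of the dual oriented matroid form the signature of the
   cocircuits of the underlying matroid that is orthogonal to all signed
   circuits. *)
Definition signed_cocircuit N d : bool :=
  [&& [disjoint d.1 & d.2], cocircuit (underlying_circuits N) (supp_ss d)
    & [forall c in N, orthogonal_ss c d]].

Definition positive_cocircuit N d : bool :=
  signed_cocircuit N d && (d.2 == set0).

Definition positive_cocycle N S : bool :=
  [exists P : {set {set A}},
    [&& trivIset P,
        [forall D in P, [exists d, positive_cocircuit N d && (D == supp_ss d)]]
      & cover P == S]].

(** ** Reorientations *)

Definition reorient_ss S c : signed_set A :=
  ((c.1 :\: S) :|: (c.2 :&: S), (c.2 :\: S) :|: (c.1 :&: S)).

Definition reorient S N : {set signed_set A} := [set reorient_ss S c | c in N].

Definition symdiff S T : {set A} := (S :\: T) :|: (T :\: S).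

Lemma reorient_symdiff S P N :
  reorient P (reorient S N) = reorient (symdiff S P) N.
Proof.
rewrite /reorient -imset_comp; apply: eq_imset => c.
rewrite /reorient_ss /symdiff /=; congr pair; apply/setP => a; rewrite !inE;
by case: (a \in S); case: (a \in P); case: (a \in c.1); case: (a \in c.2).
Qed.

(* A reorientation of N is a reorientation "on S" and is recorded by the subset
   S of A, as for the orientations of a graph: different subsets count as
   different reorientations, even though they may produce the same set of
   signed circuits. (This matters: if N has ground set {a, b} and signed
   circuits +-(ab, 0), then reorienting on {a, b}, which is a cocycle but not a
   positive one, gives back the same signed circuits. The two reorientations,
   on 0 and on {a, b}, have to be counted separately.)
   By [reorient_symdiff], reorienting P in the reorientation of N on S yields
   the reorientation of N on [symdiff S P]. *)
Definition pos_equiv N S T : bool :=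
  [exists P, positive_cocycle (reorient S N) P && (T == symdiff S P)].

Definition pos_class N S : {set {set A}} := [set T | pos_equiv N S T].

Definition cocycle_classes N : {set {set {set A}}} :=
  [set pos_class N S | S in [set S | cocycle (underlying_circuits N) S]].

Definition acyclic_cocycle_classes N : {set {set {set A}}} :=
  [set pos_class N S
    | S in [set S | cocycle (underlying_circuits N) S
                    & acyclic (reorient S N)]].

End OrientedMatroid.

(** * Regularity *)

From mathcomp Require Import all_classical all_reals.

Local Open Scope ring_scope.

Definition totally_unimodular (R : nzRingType) m n (M : 'M[R]_(m, n)) : Prop :=
  forall k (f : 'I_k -> 'I_m) (g : 'I_k -> 'I_n), injective f -> injective g ->
    \det (mxsub f g M) \in [:: -1; 0; 1].

Section Representation.
Variables (R : realType) (A : finType).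
Implicit Types (v w : {ffun A -> R}) (N : {set signed_set A}).

(* The columns of M are indexed by A through [enum_rank]. *)
Definition dependency m (M : 'M[R]_(m, #|A|)) v : Prop :=
  \sum_(a : A) v a *: col (enum_rank a) M = 0.

Definition minimal_dependency m (M : 'M[R]_(m, #|A|)) v : Prop :=
  [/\ v != 0, dependency M v
    & forall w, w != 0 -> dependency M w ->
        (forall a, w a != 0 -> v a != 0) -> (forall a, v a != 0 -> w a != 0)].

Definition sign_ss v : signed_set A :=
  ([set a | 0 < v a]%SET, [set a | v a < 0]%SET).

Definition represents m (M : 'M[R]_(m, #|A|)) N : Prop :=
  forall c : signed_set A,
    c \in N <-> exists2 v, minimal_dependency M v & c = sign_ss v.

Definition regular N : Prop :=
  exists m (M : 'M[R]_(m, #|A|)), totally_unimodular M /\ represents M N.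

(** * The sets of vectors Pi and of integer functions Omega *)

(* For disjoint signed sets this is the {-1, 0, 1}-valued incidence vector. *)
Definition incidence (c : signed_set A) : {ffun A -> R} :=
  [ffun a => (a \in c.1)%:R - (a \in c.2)%:R].

Definition inner v w : R := \sum_(a : A) v a * w a.

Definition Pi_ge N : set {ffun A -> R} :=
  [set x : {ffun A -> R} | (forall a, 0 <= x a <= 2^-1) /\
           (forall c, c \in N -> inner (incidence c) x \is a Num.int)]%classic.

Definition Pi_gt N : set {ffun A -> R} :=
  [set x : {ffun A -> R} | (forall a, 0 < x a < 2^-1) /\
           (forall c, c \in N -> inner (incidence c) x \is a Num.int)]%classic.

(* Only used at points x of Pi, where all these inner products are integers and
   [Num.floor] is merely the cast from R to int. *)
Definition alpha N (x : {ffun A -> R}) : {ffun {c | c \in N} -> int} :=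
  [ffun c => Num.floor (inner (incidence (val c)) x)].

Definition Omega_ge N : set {ffun {c | c \in N} -> int} :=
  (alpha N @` Pi_ge N)%classic.

Definition Omega_gt N : set {ffun {c | c \in N} -> int} :=
  (alpha N @` Pi_gt N)%classic.

End Representation.

Arguments Omega_ge R {A} N _.
Arguments Omega_gt R {A} N _.

(* Main.v *)
Require Import Defs.
From mathcomp Require Import all_boot all_order all_algebra.
From mathcomp Require Import all_classical all_reals.

(** Let V be the kernel of a totally unimodular matrix representing N. By
    Cramer's rule the vectors of minimal support in V are multiples of
    {0, 1, -1}-vectors, namely the incidence vectors of the circuits, and they
    span V; so alpha_x = alpha_y iff x - y is orthogonal to V. A set S is a
    cocycle iff <C, 1_S> is even for every circuit C, that is, iff 1_S / 2 lies
    in Pi_N. The polytope of the y in [0, 1]^A with y - 2x orthogonal to V has a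
    0/1 point as soon as x is in Pi_N, so every alpha_x is alpha at some 1_S / 2
    with S a cocycle. Two cocycles S, T give the same alpha iff 1_T - 1_S is
    orthogonal to V; in the reorientation on S this vector becomes the indicator
    of the symmetric difference of S and T, and it is orthogonal to the
    reoriented V iff that set is a positive cocycle. Finally, the fibre over
    alpha at 1_S / 2 meets the open box iff the orthogonal complement of the
    reoriented V contains a strictly positive vector, which by Farkas' lemma
    means that the reorientation of N on S is acyclic. *)

Set Implicit Arguments.
Unset Strict Implicit.
Unset Printing Implicit Defensive.

Import Order.TTheory GRing.Theory Num.Theory.
Local Open Scope ring_scope.

(** * Subspaces of real coordinate space *)

Section Subspaces.
Variables (R : realType) (A : finType).
Implicit Types (u v w : {ffun A -> R}) (V : {ffun A -> R} -> Prop).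
Implicit Types (a b e : A) (X G S J : {set A}).

Definition supp v : {set A} := [set a | v a != 0]%SET.

Lemma in_supp v a : (a \in supp v) = (v a != 0).
Proof. by rewrite inE. Qed.

Lemma supp_neq0 v : v != 0 -> exists a, a \in supp v.
Proof.
move=> v0; apply/set0Pn; apply: contra v0 => /eqP s0; apply/eqP/ffunP => a.
rewrite ffunE; apply/eqP; apply: contraT; rewrite -in_supp s0 inE.
by [].
Qed.

Definition axpy k v w : {ffun A -> R} := [ffun a => k * v a + w a].

(** One closure condition covers both operations: [w = 0] gives scalar multiples and [k = 1] gives
    sums. *)
Definition linear_space V := V 0 /\ forall k v w, V v -> V w -> V (axpy k v w).

Definition orthocompl V u := forall v, V v -> inner v u = 0.

(** Nonzero vectors of inclusion-minimal support, the elementary vectors of Rockafellar. Those of V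
    carry the signed circuits, those of its orthogonal complement the cocircuits. *)
Definition elementary V v :=
  [/\ v != 0, V v
    & forall w, w != 0 -> V w -> supp w \subset supp v -> supp v \subset supp w].

Lemma innerC u v : inner u v = inner v u.
Proof. by apply: eq_bigr => a _; rewrite mulrC. Qed.

Lemma inner_axpyr k u v w : inner u (axpy k v w) = k * inner u v + inner u w.
Proof.
rewrite /inner mulr_sumr -big_split /=; apply: eq_bigr => a _.
by rewrite !ffunE mulrDr mulrCA.
Qed.

Lemma inner0r u : inner u 0 = 0.
Proof. by rewrite /inner big1 // => a _; rewrite ffunE mulr0. Qed.

Lemma innerBr u v w : inner u (v - w) = inner u v - inner u w.
Proof.
rewrite /inner -sumrB; apply: eq_bigr => a _.
by rewrite !ffunE mulrBr.
Qed.

Lemma linear_orthocompl V : linear_space (orthocompl V).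
Proof.
split=> [v _|k v w Vv Vw u Vu]; first exact: inner0r.
by rewrite inner_axpyr Vv // Vw // mulr0 addr0.
Qed.

Lemma inner_gt0 u v a :
  (forall b, 0 <= u b * v b) -> 0 < u a * v a -> 0 < inner u v.
Proof.
move=> uv0 uva; rewrite /inner (bigD1 a) //=.
by rewrite ltr_wpDr // sumr_ge0.
Qed.

Lemma cancel_coordinate V v w b :
  linear_space V -> V v -> V w -> w b != 0 ->
  let z := axpy (- (v b / w b)) w v in V z /\ z b = 0.
Proof.
move=> [V0 VD] Vv Vw wb /=; split; last by rewrite !ffunE mulNr divfK ?addNr.
exact: VD.
Qed.

Lemma supp_axpy v w k X :
  supp v \subset X -> supp w \subset X -> supp (axpy k w v) \subset X.
Proof.
move=> /fintype.subsetP vX /fintype.subsetP wX;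
apply/fintype.subsetP => a; rewrite in_supp !ffunE.
case: (boolP (v a == 0)) => [/eqP->|va _]; last by apply: vX; rewrite in_supp.
case: (boolP (w a == 0)) => [/eqP->|wa _]; last by apply: wX; rewrite in_supp.
by rewrite mulr0 addr0 eqxx.
Qed.

(** Shrink the support while keeping [a] in it. Once this is impossible, a nonzero [w] in V with
    smaller support vanishes at [a], and cancelling a coordinate of [v] with it would shrink the
    support again without touching [a]. *)
Lemma elementary_through V v a : linear_space V -> V v -> v a != 0 ->
  exists w, [/\ elementary V w, w a != 0 & supp w \subset supp v].
Proof.
move=> linV; have [n] := ubnP #|supp v|; elim: n v => // n IH v lev Vv va.
case: (EM (exists w, [/\ V w, w a != 0 & supp w \proper supp v])).
  move=> [w [Vw wa wv]].
  have [|z [ez za zw]] := IH w _ Vw wa.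
    by rewrite ltnS in lev; apply: leq_trans (proper_card wv) lev.
  by exists z; split=> //; exact: fintype.subset_trans zw (fintype.proper_sub wv).
move=> minv; exists v; split=> //; split=> //.
  by apply: contra va => /eqP->; rewrite ffunE.
move=> w w0 Vw wv; apply/fintype.subsetP => b vb; apply: contraT => wb.
exfalso; have wpv : supp w \proper supp v.
  by rewrite properE wv; apply/fintype.subsetPn; exists b.
have wa : w a = 0.
  by apply/eqP; apply: contraT => wa; exfalso; apply: minv; exists w; split.
have [e we] := supp_neq0 w0; rewrite in_supp in we.
have [Vz ze] := cancel_coordinate linV Vv Vw we.
apply: minv; exists (axpy (- (v e / w e)) w v); split=> //.
  by rewrite ffunE wa mulr0 add0r.
rewrite properE supp_axpy //=; apply/fintype.subsetPn; exists e.
  by apply: (fintype.subsetP wv); rewrite in_supp.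
by rewrite in_supp ze eqxx.
Qed.

(** The same descent among nonnegative vectors, with a ratio test: subtracting [w] times the least
    [v i / w i] over [w i > 0] keeps all entries nonnegative and kills the entry at [i]. *)
Lemma nonneg_elementary V v : linear_space V -> V v -> v != 0 ->
  (forall a, 0 <= v a) ->
  exists w, [/\ elementary V w, forall a, 0 <= w a & supp w \subset supp v].
Proof.
move=> linV; have [n] := ubnP #|supp v|; elim: n v => // n IH v lev Vv v0 v_ge0.
case: (EM (exists w,
    [/\ V w, w != 0, forall a, 0 <= w a & supp w \proper supp v])).
  move=> [w [Vw w0 w_ge0 wv]].
  have [|z [ez z_ge0 zw]] := IH w _ Vw w0 w_ge0.
    by rewrite ltnS in lev; apply: leq_trans (proper_card wv) lev.
  by exists z; split=> //; exact: fintype.subset_trans zw (fintype.proper_sub wv).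
move=> minv; exists v; split=> //; split=> // w w0 Vw wv.
apply/fintype.subsetP => b vb; apply: contraT => wb; exfalso.
(* Up to replacing [w] by its negative, some entry is positive, as the ratio test requires. At [b]
   the vector [w] vanishes and [v] does not, so the difference formed below is nonzero. *)
have {w w0 Vw wv wb} [w [Vw wv /eqP wb [a wa]]] : exists w,
    [/\ V w, supp w \subset supp v, w b == 0 & exists a, 0 < w a].
  have [e we] := supp_neq0 w0; rewrite in_supp in we.
  have wb0 : w b == 0 by rewrite in_supp negbK in wb.
  have [|we0] := ltP 0 (w e); first by exists w; split=> //; exists e.
  exists (axpy (-1) w 0); split; first by apply: linV.2 => //; exact: linV.1.
  - apply: fintype.subset_trans wv; apply/fintype.subsetP => i.
    by rewrite !in_supp !ffunE mulN1r addr0 oppr_eq0.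
  - by rewrite !ffunE (eqP wb0) mulr0 addr0.
  - by exists e; rewrite !ffunE mulN1r addr0 oppr_gt0 lt_neqAle we.
case: (@arg_minP _ _ _ a (fun i => 0 < w i) (fun i => v i / w i) wa) => i wi mini.
have wi0 : w i != 0 by rewrite gt_eqF.
have [Vz zi] := cancel_coordinate linV Vv Vw wi0.
apply: minv; exists (axpy (- (v i / w i)) w v); split=> //.
- apply/negP => /eqP/ffunP/(_ b); rewrite !ffunE wb mulr0 add0r => vb0.
  by rewrite in_supp vb0 eqxx in vb.
- move=> j; rewrite !ffunE mulNr addrC subr_ge0.
  have [wj|wj] := ltP 0 (w j); first by rewrite -ler_pdivlMr // mini.
  by apply: le_trans (v_ge0 j); rewrite mulr_ge0_le0 // divr_ge0 // ltW.
- rewrite properE supp_axpy //=; apply/fintype.subsetPn; exists i.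
    by apply: (fintype.subsetP wv); rewrite in_supp.
  by rewrite in_supp zi eqxx.
Qed.

(** * Theorems of the alternative *)

(** For the kernel of a matrix: column [a] either is a combination of the columns in [X] or is
    separated from them by a linear functional. Stated as a property of V, it can be carried over to
    reorientations without a matrix. *)
Definition fredholm V := forall X a, a \notin X ->
  (exists v, [/\ V v, v a = 1 & forall b, b \notin X -> b != a -> v b = 0]) \/
  (exists u, [/\ orthocompl V u, u a = 1 & forall b, b \in X -> u b = 0]).

(* Minty's induction on [G]: for [g] in [G], solve the problem with [g] made
   free for [v], and with [g] made free for [u]. If neither solution has the
   required sign at [g], the remaining [v] and [u] are both negative at [g],
   so that their inner product is positive. *)
Lemma farkas V G X a : fredholm V ->
  a \notin G -> a \notin X -> [disjoint G & X] ->
  (exists v, [/\ V v, v a = 1, forall b, b \in G -> 0 <= v b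
     & forall b, b \notin X :|: G -> b != a -> v b = 0]) \/
  (exists u, [/\ orthocompl V u, u a = 1, forall b, b \in G -> 0 <= u b
     & forall b, b \in X -> u b = 0]).
Proof.
move=> frV; have [n] := ubnP #|G|; elim: n G X => // n IH G X leG aG aX GX.
have [->|[g gG]] := set_0Vmem G.
  have [[v [Vv va v0]]|[u [Vu ua u0]]] := frV X a aX; [left|right].
    by exists v; split=> // b; rewrite ?inE // orbF; exact: v0.
  by exists u; split=> // b; rewrite inE.
have leG' : (#|(G :\ g)%SET| < n)%N by move: leG; rewrite (cardsD1 g) gG.
have aG' : a \notin (G :\ g)%SET by rewrite !inE (negPf aG) andbF.
have ag : a != g by apply: contraNneq aG => ->.
have agX : a \notin (g |: X)%SET by rewrite !inE (negPf ag).
have gX : g \notin X by rewrite (disjointFr GX gG).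
have G'X : [disjoint (G :\ g)%SET & X].
  by apply: fintype.disjointWl GX; rewrite subD1set.
have G'gX : [disjoint (G :\ g)%SET & (g |: X)%SET].
  apply/pred0P => b /=; rewrite !inE; case: eqVneq => //= _.
  by apply/negP => /andP[bG bX]; rewrite (disjointFr GX bG) in bX.
have inG b : b \in G -> b = g \/ b \in (G :\ g)%SET.
  by move=> bG; rewrite !inE bG andbT; case: eqVneq => [|_]; [left|right].
have [[v [Vv va vG vX]]|[u [Vu ua uG uX]]] := IH _ _ leG' aG' agX G'gX;
    last first.
  right; exists u; split=> // b.
    by move=> /inG[->|/uG//]; rewrite uX // !inE eqxx.
  by move=> bX; apply: uX; rewrite inE bX orbT.
have [[w [Vw wa wG wX]]|[u [Vu ua uG uX]]] := IH _ _ leG' aG' aX G'X.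
  left; exists w; split=> // b.
    move=> /inG[->|/wG//]; rewrite wX // 1?eq_sym //.
    by rewrite !inE (negPf gX) eqxx.
  move=> bXG ba; apply: wX => //; apply: contra bXG.
  by rewrite !inE => /orP[->//|/andP[_ ->]]; rewrite orbT.
have [vg|vg] := leP 0 (v g).
  left; exists v; split=> // b; first by move=> /inG[->|/vG//].
  move=> bXG ba; apply: vX => //; apply: contra bXG; rewrite !inE.
  by case: eqVneq => [->|_]; rewrite ?gG ?orbT.
have [ug|ug] := leP 0 (u g).
  by right; exists u; split=> // b /inG[->|/uG].
have := Vu v Vv; suff /[swap] -> : 0 < inner v u by rewrite ltxx.
apply: (@inner_gt0 v u a); last by rewrite va ua mulr1.
move=> b; have [->|ba] := eqVneq b a; first by rewrite va ua mulr1.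
have [->|bg] := eqVneq b g; first by rewrite mulr_le0 // ltW.
have [bG|bG] := boolP (b \in (G :\ g)%SET); first by rewrite mulr_ge0 ?vG ?uG.
have [bX|bX] := boolP (b \in X); first by rewrite uX // mulr0.
by rewrite vX ?mul0r // finset.in_setU finset.in_setU1 (negPf bg) (negPf bX) (negPf bG).
Qed.

End Subspaces.

(** * Kernels of totally unimodular matrices *)

Section Dependencies.
Variables (R : realType) (A : finType) (m : nat) (M : 'M[R]_(m, #|A|)).
Implicit Types (u v w : {ffun A -> R}) (a b : A) (X : {set A}).

Local Notation V := (dependency M).

Lemma dependencyE v :
  V v <-> forall i, \sum_a v a * M i (enum_rank a) = 0.
Proof.
split=> [/matrixP Mv i|Mv].
  move: (Mv i 0); rewrite summxE [RHS]mxE; apply: etrans.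
  by apply: eq_bigr => a _; rewrite !mxE.
apply/matrixP => i j; rewrite summxE [RHS]mxE; apply: etrans _ (Mv i).
by apply: eq_bigr => a _; rewrite !mxE.
Qed.

Lemma linear_dependency : linear_space V.
Proof.
split; first by apply/dependencyE => i; rewrite big1 // => a _; rewrite ffunE mul0r.
move=> k v w /dependencyE Mv /dependencyE Mw; apply/dependencyE => i.
under eq_bigr do rewrite ffunE mulrDl -mulrA.
by rewrite big_split -mulr_sumr /= Mv Mw mulr0 addr0.
Qed.

Lemma minimal_dependencyE v : minimal_dependency M v <-> elementary V v.
Proof.
split=> -[v0 Vv minv]; split=> // w w0 Vw.
  move=> /fintype.subsetP wv; apply/fintype.subsetP => a; rewrite in_supp => va.
  rewrite in_supp; apply: (minv w) => // b wb.
  by move: (wv b); rewrite !in_supp; exact.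
move=> wv a va; have /minv/(_ Vw) := w0.
have -> : supp w \subset supp v.
  by apply/fintype.subsetP => b; rewrite !in_supp; exact: wv.
by move=> /(_ isT)/fintype.subsetP/(_ a); rewrite !in_supp; exact.
Qed.

(** Coefficients expressing column [a] through the columns in [X] give [v]. Otherwise a functional
    from the cokernel separates them, and its values on all columns form a vector of the row space,
    which is orthogonal to the kernel. *)
Lemma fredholm_dependency : fredholm V.
Proof.
move=> X a aX; pose r b : 'rV_m := (col (enum_rank b) M)^T.
(* Columns outside [X] are replaced by zero instead of being dropped, so that the index set stays
   all of [A]. *)
pose B : 'M[R]_(#|A|, m) := \matrix_i if enum_val i \in X then r (enum_val i) else 0.
have rowB b : row (enum_rank b) B = if b \in X then r b else 0.
  by rewrite rowK enum_rankK.
have [/submxP[w rw]|] := boolP (r a <= B)%MS.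
  left; exists [ffun b => (b == a)%:R - (b \in X)%:R * w 0 (enum_rank b)].
  split=> [||b bX ba]; last first.
  - by rewrite ffunE (negPf ba) (negPf bX) mul0r subrr.
  - by rewrite ffunE eqxx (negPf aX) mul0r subr0.
  apply/dependencyE => i; under eq_bigr do rewrite ffunE mulrBl.
  rewrite sumrB (bigD1 a) //= eqxx mul1r big1 ?addr0 => [|b /negPf->]; last first.
    by rewrite mul0r.
  have /matrixP/(_ 0 i) := rw; rewrite !mxE => ->; apply/eqP; rewrite subr_eq0.
  rewrite (reindex (@enum_val A A)) /=; last exact/onW_bij/enum_val_bij.
  apply/eqP/eq_bigr => j _; rewrite mxE.
  by case: ifP => _; rewrite ?mul1r ?mul0r ?mulr0 mxE ?mulr0 // mxE enum_valK.
rewrite submxE => /matrix0Pn[i0 [j]]; rewrite [i0]ord1 => {i0} yj.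
(* Column [j] of the cokernel is a functional that kills the columns in [X] but not column [a];
   dividing by [y a] normalises it. *)
right; pose y b := (r b *m cokermx B) 0 j.
have ya : y a != 0 by [].
have yE b : y b = \sum_i M i (enum_rank b) * cokermx B i j.
  by rewrite /y mxE; apply: eq_bigr => i _; rewrite !mxE.
exists [ffun b => y b / y a]; split=> [v /dependencyE Mv||b bX]; last first.
- have rb : r b = row (enum_rank b) B by rewrite rowB bX.
  by rewrite ffunE /y rb -row_mul mulmx_coker !mxE mul0r.
- by rewrite ffunE divff.
rewrite /inner; under eq_bigr => b _.
  rewrite ffunE yE mulrA mulr_sumr mulr_suml.
  under eq_bigr do rewrite mulrA; over.
rewrite exchange_big /= big1 // => i _.
by rewrite -!mulr_suml Mv !mul0r.
Qed.

End Dependencies.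

(** * Cramer's rule and the entries of elementary vectors *)

Section TU.
Variables (R : realType) (A : finType) (m : nat) (M : 'M[R]_(m, #|A|)).
Implicit Types (u v w : {ffun A -> R}) (a b : A) (X : {set A}).

(** [P'] is described entrywise, so that it can be instantiated with another submatrix of the same
    matrix. *)
Lemma cramer (F : comNzRingType) k (P P' : 'M[F]_k) (z q : 'cV[F]_k) i :
  P *m z = q -> (forall r j, P' r j = if j == i then q r 0 else P r j) ->
  \det P * z i 0 = \det P'.
Proof.
move=> Pz P'E; have /matrixP/(_ i 0) : \adj P *m P *m z = (\det P)%:M *m z.
  by rewrite mul_adj_mx.
rewrite mul_scalar_mx [X in _ = X]mxE => <-;
rewrite -mulmxA Pz mxE (expand_det_col _ i).
apply: eq_bigr => r _; rewrite mxE P'E eqxx mulrC /cofactor; congr (_ * (_ * \det _)).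
by apply/matrixP => s j; rewrite !mxE P'E eq_sym (negPf (neq_lift _ _)).
Qed.

(** A linear relation among the columns in [K], extended by zero, is a dependency whose support is
    properly contained in that of [v]; by minimality it is zero. *)
Lemma elementary_colsub_full v (K : {set A}) :
  elementary (dependency M) v -> K \proper supp v ->
  row_full (colsub (fun i : 'I_#|K| => enum_rank (enum_val i)) M).
Proof.
move=> [_ _ minv] Kv; set Q := colsub _ M.
suff : row_free Q^T by rewrite /row_free /row_full mxrank_tr.
apply: inj_row_free => z zQ.
have [K0|[b bK]] := set_0Vmem K.
  by apply/rowP => i; have := enum_valP i; by rewrite {2}K0 inE.
pose w : {ffun A -> R} := [ffun c => if c \in K then z 0 (enum_rank_in bK c) else 0].
have wK : supp w \subset K.
  apply/fintype.subsetP => c; rewrite in_supp ffunE; case: ifP => //.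
  by rewrite eqxx.
have w0 : w = 0.
  apply/eqP; apply: contraT => w0; have := Kv.
  rewrite properE => /andP[Kv' /negP[]]; apply: (fintype.subset_trans _ wK).
  apply: minv => //; last exact: (fintype.subset_trans wK Kv').
  apply/dependencyE => i; have /matrixP/(_ 0 i) := zQ; rewrite !mxE; apply: etrans.
  under [RHS]eq_bigr do rewrite !mxE.
  rewrite (bigID [in K]) /= addrC big1 ?add0r => [|c /negPf cK]; last first.
    by rewrite ffunE cK mul0r.
  rewrite big_enum_val /=; apply: eq_bigr => j _.
  by rewrite ffunE enum_valP enum_valK_in.
apply/rowP => i; move/ffunP: w0 => /(_ (enum_val i)).
by rewrite !mxE !ffunE enum_valP enum_valK_in.
Qed.

(** The columns of the support other than [a] are independent, so some rows cut out an invertible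
    square matrix [P]. Cramer's rule writes [v b / - v a] as a quotient of two nonzero minors, both
    of absolute value 1. *)
Lemma tu_elementary v a b : totally_unimodular M -> elementary (dependency M) v ->
  v a != 0 -> v b != 0 -> `|v a| = `|v b|.
Proof.
move=> tuM ev va vb; have [->//|ab] := eqVneq a b.
pose K := (supp v :\ a)%SET.
have Kv : K \proper supp v by rewrite properD1 // in_supp.
have bK : b \in K by rewrite !inE eq_sym ab.
pose g (i : 'I_#|K|) := enum_rank (enum_val i).
pose ib := enum_rank_in bK b.
have gb : enum_val ib = b by rewrite /ib enum_rankK_in.
pose f := fullrankfun (elementary_colsub_full ev Kv).
(* Column [b] is exchanged for column [a]: this selects the numerator in Cramer's rule. *)
pose g' i := if i == ib then enum_rank a else g i.
have injf : injective f by exact: fullrankfun_inj.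
have injg : injective g by move=> i j /enum_rank_inj/enum_val_inj.
have ga i : enum_rank a != g i.
  by apply: contraTneq (enum_valP i) => /enum_rank_inj <-; rewrite setD11.
have injg' : injective g'.
  move=> i j; rewrite /g'.
  case: (eqVneq i ib) => [->|_]; case: (eqVneq j ib) => [->|_] //; last exact: injg.
    by move=> e; case/eqP: (ga j).
  by move=> e; case/eqP: (ga i).
pose P := mxsub f g M.
have Punit : \det P != 0.
  have := fullrowsub_unit (elementary_colsub_full ev Kv).
  by rewrite unitmxE unitfE -mxsub_comp.
(* The coefficients of column [a] in terms of the columns in [K], read off from the dependency
   [v]. *)
pose z : 'cV[R]_#|K| := \col_i (v (enum_val i) / - v a).
have Pz : P *m z = \col_i M (f i) (enum_rank a).
  apply/matrixP => i j; rewrite !mxE.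
  have [_ /dependencyE/(_ (f i)) + _] := ev.
  rewrite (bigD1 a) //= => /eqP; rewrite addrC addr_eq0 => /eqP e.
  have va' : - v a != 0 by rewrite oppr_eq0.
  apply: (mulfI va'); rewrite [RHS]mulNr -{}e (bigID [in K]) /=.
  rewrite [X in _ = _ + X]big1 ?addr0 => [|c /andP[ca]]; last first.
    by rewrite !inE ca /= negbK => /eqP->; rewrite mul0r.
  rewrite (eq_bigl [in K]) => [|c]; last by rewrite !inE; case: eqP.
  rewrite [RHS]big_enum_val mulr_sumr /=; apply: eq_bigr => l _.
  by rewrite ?mxE mulrCA [_ * (_ / _)]mulrCA divff // mulr1 mulrC.
have := cramer (i := ib) (P' := mxsub f g' M) Pz; rewrite mxE gb => crm.
have {crm} : \det P * (v b / - v a) = \det (mxsub f g' M).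
  by apply: crm => r j; rewrite !mxE /g'; case: ifP.
have := tuM _ _ _ injf injg; have := tuM _ _ _ injf injg'; rewrite -/P => t' t e.
have unit_norm (x : R) : x \in [:: -1; 0; 1] -> x != 0 -> `|x| = 1.
  by rewrite !inE => /or3P[]/eqP-> //; rewrite ?normrN1 ?normr1 ?eqxx.
have := congr1 Num.norm e; rewrite normrM (unit_norm _ t) // mul1r.
rewrite (unit_norm _ t'); last first.
  by rewrite -e !mulf_neq0 // invr_eq0 oppr_eq0.
rewrite normrM normfV normrN => /(canRL (divfK _)) -> //; rewrite ?mul1r //.
by rewrite normr_eq0.
Qed.

End TU.

(** * Circuits and cocircuits *)

Section RegularSystems.
Variables (R : realType) (A : finType).
Implicit Types (u v w x y : {ffun A -> R}) (V : {ffun A -> R} -> Prop).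
Implicit Types (a b e : A) (X B D I J S T P : {set A}).
Implicit Types (c d : signed_set A) (N : {set signed_set A}).

(** All that is kept of a totally unimodular representation. These properties pass to
    reorientations, so the results below apply to them directly. *)
Record regular_system V N : Prop := RegularSystem {
  rs_linear : linear_space V;
  rs_fredholm : fredholm V;
  rs_unimodular : forall v a b, elementary V v ->
    v a != 0 -> v b != 0 -> `|v a| = `|v b|;
  rs_circuits : forall c, c \in N <-> exists2 v, elementary V v & c = sign_ss v }.

Definition ind S : {ffun A -> R} := [ffun a => (a \in S)%:R].

Lemma supp_ind S : supp (ind S) = S.
Proof. by apply/setP => a; rewrite in_supp ffunE pnatr_eq0 eqb0 negbK. Qed.

Lemma inner_ind v S : inner v (ind S) = \sum_(a in S) v a.
Proof.
rewrite [RHS]big_mkcond; apply: eq_bigr => a _; rewrite ffunE.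
by case: ifP => _; rewrite ?mulr1 ?mulr0.
Qed.

Lemma ind_setD D S : D \subset S -> ind (S :\: D) = ind S - ind D.
Proof.
move=> /fintype.subsetP DS; apply/ffunP => a; rewrite !ffunE !inE.
by case: (boolP (a \in D)) => [/DS->|]; rewrite ?subrr ?subr0.
Qed.

Lemma inner_single v u a : (forall b, b != a -> v b * u b = 0) ->
  inner v u = v a * u a.
Proof. by move=> vu0; rewrite /inner (bigD1 a) //= big1 ?addr0. Qed.

Lemma supp_sign v : supp_ss (sign_ss v) = supp v.
Proof.
by apply/setP => a; rewrite /supp_ss /sign_ss /= !inE; case: ltrgtP.
Qed.

Lemma incidence_sign v a : incidence R (sign_ss v) a = Num.sg (v a).
Proof.
rewrite ffunE !inE; case: (ltrgtP (v a) 0) => [va|va|->].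
- by rewrite ltr0_sg // sub0r.
- by rewrite gtr0_sg // subr0.
- by rewrite sgr0 subr0.
Qed.

Section Theory.
Variables (V : {ffun A -> R} -> Prop) (N : {set signed_set A}).
Hypothesis regVN : regular_system V N.

Let linV := rs_linear regVN.
Let linVo := linear_orthocompl V.

Lemma elementary_incidence v : elementary V v ->
  exists2 k, k != 0 & v = axpy k (incidence R (sign_ss v)) 0.
Proof.
move=> ev; have [v0 _ _] := ev; have [a] := supp_neq0 v0; rewrite in_supp => va.
exists `|v a|; first by rewrite normr_eq0.
apply/ffunP => b; rewrite ffunE incidence_sign ffunE addr0.
have [->|vb] := eqVneq (v b) 0; first by rewrite sgr0 mulr0.
by rewrite (rs_unimodular regVN ev va vb) mulrC -numEsg.
Qed.

Lemma circuit_space c : c \in N -> V (incidence R c).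
Proof.
move=> /(rs_circuits regVN)[v ev ->]; have [k k0 vE] := elementary_incidence ev.
have -> : incidence R (sign_ss v) = axpy k^-1 v 0.
  by apply/ffunP => a; rewrite {2}vE !ffunE !addr0 mulKf.
by apply: linV.2; [case: ev|exact: linV.1].
Qed.

Lemma supp_incidence c : c \in N -> supp (incidence R c) = supp_ss c.
Proof.
move=> /(rs_circuits regVN)[v _ ->]; rewrite supp_sign; apply/setP => a.
by rewrite !in_supp incidence_sign sgr_eq0.
Qed.

Lemma norm_incidence c a : c \in N -> a \in supp_ss c -> `|incidence R c a| = 1.
Proof.
move=> /(rs_circuits regVN)[v _ ->]; rewrite supp_sign in_supp incidence_sign.
by rewrite normr_sg => ->.
Qed.

Lemma incidence_out c a : a \notin supp_ss c -> incidence R c a = 0.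
Proof.
by rewrite ffunE /supp_ss inE negb_or => /andP[/negPf-> /negPf->]; rewrite subrr.
Qed.

Lemma incidence_int c a : incidence R c a \is a Num.int.
Proof. by rewrite ffunE rpredB // natr_int. Qed.

Lemma circuit_through v a : V v -> v a != 0 ->
  exists c, [/\ c \in N, a \in supp_ss c & supp_ss c \subset supp v].
Proof.
move=> Vv va; have [w [ew wa wv]] := elementary_through linV Vv va.
exists (sign_ss w); rewrite supp_sign in_supp; split=> //.
by apply/(rs_circuits regVN); exists w.
Qed.

Lemma circuit_neq0 c : c \in N -> exists a, a \in supp_ss c.
Proof.
move=> /(rs_circuits regVN)[v [v0 _ _] ->]; rewrite supp_sign; exact: supp_neq0.
Qed.

(** The circuits span V: subtracting a multiple of a circuit inside the support of [v] removes a
    coordinate from that support. *)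
Lemma orthocompl_circuits u :
  orthocompl V u <-> forall c, c \in N -> inner (incidence R c) u = 0.
Proof.
split=> [Vu c cN|Nu v]; first exact/Vu/circuit_space.
have [n] := ubnP #|supp v|; elim: n v => // n IH v lev Vv.
have [->|v0] := eqVneq v 0; first by rewrite innerC inner0r.
have [a] := supp_neq0 v0; rewrite in_supp => va.
have [c [cN ca cv]] := circuit_through Vv va.
have c0 : incidence R c a != 0 by rewrite -in_supp supp_incidence.
have [Vz za] := cancel_coordinate linV Vv (circuit_space cN) c0.
have := IH _ _ Vz; rewrite innerC inner_axpyr innerC Nu // mulr0 add0r innerC.
apply; rewrite ltnS in lev; apply: leq_trans lev; apply: proper_card.
rewrite properE supp_axpy ?supp_incidence //=; apply/fintype.subsetPn.
by exists a; rewrite in_supp // za eqxx.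
Qed.

(** The Fredholm alternative with the complement of [J] as free set: [v] vanishes on [J] except at
    [a], and so does any circuit within its support. Each use rules out one of the two sides. *)
Lemma circuit_or_cocycle J a : a \in J ->
  (exists2 c, c \in N & a \in supp_ss c /\
     forall b, b \in J -> b \in supp_ss c -> b = a) \/
  (exists u, [/\ orthocompl V u, u a = 1 & supp u \subset J]).
Proof.
move=> aJ; have aJ' : a \notin (~: J)%SET by rewrite inE aJ.
have [[v [Vv va v0]]|[u [Vu ua u0]]] := rs_fredholm regVN aJ'; [left|right].
  have [|c [cN ca /fintype.subsetP cv]] := @circuit_through v a Vv.
    by rewrite va oner_eq0.
  exists c => //; split=> // b bJ /cv; rewrite in_supp => vb.
  by apply/eqP; apply: contraNT vb => ba; rewrite v0 // inE bJ.
exists u; split=> //; apply/fintype.subsetP => b; rewrite in_supp => ub.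
by apply: contraNT ub => bJ; rewrite u0 // inE.
Qed.

(* Dropping [b] from the support of [u] leaves no room for a cocycle, hence a
   circuit meets that support in [a] and [b] only. *)
Lemma circuit_pair u a b : elementary (orthocompl V) u ->
  u a != 0 -> u b != 0 -> a != b ->
  exists2 c, c \in N & [/\ a \in supp_ss c, b \in supp_ss c,
    forall e, u e != 0 -> e \in supp_ss c -> e = a \/ e = b
    & incidence R c a * u a + incidence R c b * u b = 0].
Proof.
move=> [u0 Vu minu] ua ub ab.
have aJ : a \in (supp u :\ b)%SET by rewrite !inE ab.
have [[c cN [ca cJ]]|[w [Vw wa wJ]]] := circuit_or_cocycle aJ; last first.
  have : supp u \subset supp w.
    apply: minu => //; last by apply: fintype.subset_trans wJ (subD1set _ _).
    by apply: contra_eq_neq wa => ->; rewrite ffunE eq_sym oner_eq0.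
  move=> /fintype.subsetP/(_ b); rewrite in_supp => /(_ ub).
  by move/(fintype.subsetP wJ); rewrite setD11.
have cab e : u e != 0 -> e \in supp_ss c -> e = a \/ e = b.
  move=> ue ce; have [->|eb] := eqVneq e b; [by right|left].
  by apply: cJ => //; rewrite !inE eb.
have cu : incidence R c a * u a + incidence R c b * u b = 0.
  rewrite -[RHS](Vu _ (circuit_space cN)) /inner (bigD1 a) //=.
  rewrite (bigD1 b) 1?eq_sym //= big1 ?addr0 // => e /andP[ea eb].
  have [->|ue] := eqVneq (u e) 0; first by rewrite mulr0.
  have [ce|ce] := boolP (e \in supp_ss c); last by rewrite incidence_out ?mul0r.
  by case: (cab _ ue ce) => eE; rewrite eE eqxx in ea eb.
exists c => //; split=> //; apply: contraT => cb; move/eqP: cu.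
rewrite (incidence_out cb) mul0r addr0 mulf_eq0 (negPf ua) orbF.
by rewrite -normr_eq0 norm_incidence // oner_eq0.
Qed.

(** A circuit meeting the support of [u] in [a] and [b] only has entries 1 or -1 there, so
    orthogonality forces [u a] and [u b] to agree up to sign. *)
Lemma dual_unimodular u a b : elementary (orthocompl V) u ->
  u a != 0 -> u b != 0 -> `|u a| = `|u b|.
Proof.
move=> eu ua ub; have [->//|ab] := eqVneq a b.
have [c cN [ca cb _ /eqP]] := circuit_pair eu ua ub ab.
rewrite addr_eq0 => /eqP/(congr1 Num.norm).
by rewrite normrN !normrM !norm_incidence // !mul1r.
Qed.

(** * Independence and coindependence in terms of V and its orthogonal complement *)

Local Notation F := (underlying_circuits N).

Lemma indepP I :
  indep F I <-> forall v, V v -> supp v \subset I -> v = 0.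
Proof.
split=> [/forall_inP indI v Vv vI|indI].
  apply/eqP; apply: contraT => v0; have [a] := supp_neq0 v0.
  rewrite in_supp => /(circuit_through Vv)[c [cN _ cv]].
  have /indI/negP[] : supp_ss c \in F by apply: imset_f.
  exact: fintype.subset_trans cv vI.
apply/forall_inP => K /imsetP[c cN ->]; apply/negP => cI.
have [a ca] := circuit_neq0 cN; have := indI _ (circuit_space cN).
rewrite supp_incidence // => /(_ cI)/ffunP/(_ a)/eqP; rewrite [X in _ == X]ffunE.
by rewrite -normr_eq0 norm_incidence // oner_eq0.
Qed.

Lemma dependent_extension B a : indep F B -> ~~ indep F (a |: B)%SET ->
  exists v, [/\ V v, v a != 0 & forall b, b \notin B -> b != a -> v b = 0].
Proof.
move=> /indepP indB /negP nind; apply: contrapT => nv; apply: nind.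
apply/indepP => v Vv /fintype.subsetP vB; apply: indB => //.
have v_out b : b \notin B -> b != a -> v b = 0.
  move=> bB ba; apply/eqP; apply: contraT; rewrite -in_supp => /vB.
  by rewrite !inE (negPf bB) (negPf ba).
apply/fintype.subsetP => b; rewrite in_supp => vb; apply: contraT => bB.
have [ba|ba] := eqVneq b a; last by rewrite v_out ?eqxx in vb.
by exfalso; apply: nv; exists v; split=> //; rewrite -ba.
Qed.

Lemma base_dependent B a : base F B -> a \notin B -> ~~ indep F (a |: B)%SET.
Proof.
move=> /maxsetP[_ maxB]; apply: contra => /maxB <-; first by rewrite setU11.
exact: subsetU1.
Qed.

(** If [J] avoids a base [B], a nonzero [u] supported in [J] would meet some fundamental circuit of
    [B] in one element, against orthogonality. Conversely, a maximal independent subset of the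
    complement of [J] is shown to be a base. *)
Lemma coindepP J :
  coindep F J <-> forall u, orthocompl V u -> supp u \subset J -> u = 0.
Proof.
split=> [/existsP[B /andP[baseB JB]] u Vu uJ|Jindep].
  have [indB _] := maxsetP baseB.
  apply/eqP; apply: contraT => u0; have [a ua] := supp_neq0 u0.
  have u_in b : b \in B -> u b = 0.
    move=> bB; apply/eqP; apply: contraT; rewrite -in_supp.
    by move=> /(fintype.subsetP uJ)/(fintype.subsetP JB); rewrite inE bB.
  have aB : a \notin B.
    by apply/negP => /u_in; apply/eqP; rewrite -in_supp.
  have [v [Vv va v_out]] := dependent_extension indB (base_dependent baseB aB).
  have := Vu _ Vv; rewrite (@inner_single v u a) => [/eqP|b ba].
    by rewrite mulf_eq0 (negPf va) -[_ == _]negbK -in_supp ua.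
  have [/u_in->|bB] := boolP (b \in B); first by rewrite mulr0.
  by rewrite v_out ?mul0r.
have indep0 : indep F finset.set0.
  apply/indepP => v Vv; rewrite finset.subset0 => /eqP v0.
  by apply/ffunP => a; apply/eqP; rewrite ffunE -[_ == _]negbK -in_supp v0 inE.
have [|B /maxsetP[/andP[indB BJ] maxB] _] :=
    @maxset_exists _ (fun I => indep F I && (I \subset ~: J)) finset.set0.
  by rewrite indep0 finset.sub0set.
have JB : J \subset ~: B.
  by rewrite -finset.disjoints_subset disjoint_sym finset.disjoints_subset.
apply/existsP; exists B; rewrite JB andbT; apply/maxsetP; split=> // B' indB' BB'.
apply/eqP; rewrite finset.eqEsubset BB' andbT; apply/fintype.subsetP => a aB'.
apply: contraT => aB.
(* Let [a] enlarge [B] inside the independent set [B']. A dependency of [a] on [B] contradicts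
   independence of [B']; otherwise some [u] vanishes on [B] but not at [a]. *)
have [[v [Vv va v_out]]|[u [Vu ua u_in]]] := rs_fredholm regVN aB.
  have v0 := (indepP B').1 indB' v Vv.
  move: va; rewrite v0 ?ffunE => [/eqP|]; first by rewrite eq_sym oner_eq0.
  apply/fintype.subsetP => b; rewrite in_supp => vb; apply: contraNT vb => bB'.
  rewrite v_out //; first by apply: contra bB'; exact: (fintype.subsetP BB').
  by apply: contraNneq bB' => ->.
(* Outside [J], maximality of [B] makes each further element [f] dependent on [B], and orthogonality
   to that dependency gives [u f = 0]. So [u] is supported in [J]. *)
have u0 : u = 0.
  apply: Jindep => //; apply/fintype.subsetP => f; rewrite in_supp => uf.
  apply: contraT => fJ.
  have fB : f \notin B by apply: contraNN uf => /u_in ->.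
  have nindf : ~~ indep F (f |: B)%SET.
    apply/negP => indf; have := maxB (f |: B)%SET.
    rewrite indf subsetU1 finset.subUset finset.sub1set inE fJ BJ => /(_ isT isT) BE.
    by rewrite -BE setU11 in fB.
  have [v [Vv vf v_out]] := dependent_extension indB nindf.
  have := Vu _ Vv; rewrite (@inner_single v u f) => [/eqP|b ba].
    by rewrite mulf_eq0 (negPf vf) (negPf uf).
  have [/u_in->|bB] := boolP (b \in B); first by rewrite mulr0.
  by rewrite v_out ?mul0r.
by move: ua; rewrite u0 ffunE => /eqP; rewrite eq_sym oner_eq0.
Qed.

Lemma cocircuitP D :
  cocircuit F D <-> exists2 u, elementary (orthocompl V) u & D = supp u.
Proof.
have ncoind J : ~~ coindep F J ->
    exists u, [/\ u != 0, orthocompl V u & supp u \subset J].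
  move=> /negP nJ; apply: contrapT => nu; apply: nJ; apply/coindepP => u Vu uJ.
  by apply/eqP; apply: contraT => u0; exfalso; apply: nu; exists u.
have coindN u : u != 0 -> orthocompl V u -> ~~ coindep F (supp u).
  by move=> u0 Vu; apply: contra u0 => /coindepP/(_ u Vu) ->.
split=> [/minsetP[/ncoind[u [u0 Vu uD]] minD]|[u [u0 Vu minu] ->]].
  have suD := minD _ (coindN _ u0 Vu) uD.
  exists u => //; split=> // w w0 Vw wu.
  by rewrite suD (minD _ (coindN _ w0 Vw)) // -suD.
apply/minsetP; split=> [|B /ncoind[w [w0 Vw wB]] Bu]; first exact: coindN.
apply/eqP; rewrite finset.eqEsubset Bu /=; apply: (fintype.subset_trans _ wB).
by apply: minu => //; exact: (fintype.subset_trans wB Bu).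
Qed.

End Theory.
End RegularSystems.

(** * Cocycles, acyclicity and integral points *)

(** Good sets are split off one at a time, [Q] being kept by the remainder. It serves both cocycles
    and positive cocycles. *)
Lemma disjoint_decomposition (A : finType) (good : {set A} -> Prop)
    (Q : {set A} -> Prop) :
  (forall S, Q S -> S != finset.set0 ->
     exists D, [/\ good D, D != finset.set0, D \subset S & Q (S :\: D)%SET]) ->
  forall S, Q S -> exists P : {set {set A}},
    [/\ finset.trivIset P, finset.cover P = S & forall D, D \in P -> good D].
Proof.
move=> step S QS.
(* Excluding the empty set from [P] ensures that the next piece is not already a member of [P]. *)
suff [P [trivP coverP _ goodP]] : exists P : {set {set A}},
    [/\ finset.trivIset P, finset.cover P = S, finset.set0 \notin P
      & forall D, D \in P -> good D] by exists P.
have [n] := ubnP #|S|; elim: n S QS => // n IH S QS leS.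
have [->|S0] := eqVneq S finset.set0.
  exists finset.set0; rewrite /finset.trivIset /finset.cover !big_set0 cards0 inE.
  by split=> // D; rewrite inE.
have [D [goodD D0 DS QSD]] := step S QS S0.
have ltSD : (#|S :\: D| < n)%N.
  rewrite ltnS in leS; apply: leq_trans leS; apply: proper_card.
  rewrite properE subsetDl /=; apply/fintype.subsetPn.
  have /set0Pn[a aD] := D0.
  by exists a; [exact: (fintype.subsetP DS)|rewrite inE aD].
have [P [trivP coverP P0 goodP]] := IH _ QSD ltSD.
have disjD : {in P, forall B : {set A}, [disjoint D & B]}.
  move=> B BP; apply/pred0P => a /=; apply/negP => /andP[aD aB].
  have : a \in finset.cover P by apply/bigcupP; exists B.
  by rewrite coverP inE aD.
have [trivDP DP] := trivIsetU1 disjD trivP P0.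
exists (D |: P)%SET; split=> //.
- rewrite /finset.cover big_setU1 //= -/(finset.cover P) coverP.
  apply/setP => a; rewrite !inE; case: (boolP (a \in D)) => //= aD.
  by rewrite (fintype.subsetP DS).
- by rewrite !inE negb_or eq_sym D0.
- by move=> B; rewrite !inE => /orP[/eqP->|/goodP].
Qed.

Section Cocycles.
Variables (R : realType) (A : finType).
Variables (V : {ffun A -> R} -> Prop) (N : {set signed_set A}).
Hypothesis regVN : regular_system V N.
Implicit Types (u v w x y : {ffun A -> R}).
Implicit Types (a b e : A) (X B D I J S T P : {set A}) (c d : signed_set A).

Let linV := rs_linear regVN.
Let linVo := linear_orthocompl V.
Local Notation F := (underlying_circuits N).

Lemma half_notin_int (x : R) : `|x| = 1 -> x / 2 \is a Num.int -> False.
Proof.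
move=> x1 /norm_intr_ge1; rewrite mulf_eq0 invr_eq0 pnatr_eq0 orbF.
rewrite -normr_eq0 x1 oner_eq0 normrM x1 mul1r normfV normr_nat => /(_ isT).
by rewrite invf_ge1 ?ltr0n // lern1.
Qed.

Definition even_on S := forall c, c \in N ->
  inner (incidence R c) (ind R S) / 2 \is a Num.int.

Lemma inner_cover v (P : {set {set A}}) : finset.trivIset P ->
  inner v (ind R (finset.cover P)) = \sum_(D in P) inner v (ind R D).
Proof.
move=> trivP; rewrite inner_ind big_trivIset //.
by apply: eq_bigr => D _; rewrite inner_ind.
Qed.

Lemma even_cocircuit D : cocircuit F D -> even_on D.
Proof.
move=> /(cocircuitP regVN)[u eu ->] c cN.
have [u0 Vu _] := eu; have [a] := supp_neq0 u0; rewrite in_supp => ua.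
have uc := Vu _ (circuit_space regVN cN).
(* Scaled by [u a], the vector [u] has entries 1 or -1 on its support. Subtracting it from the
   indicator does not change the inner product and leaves entries 0 and 2 only. *)
have -> : inner (incidence R c) (ind R (supp u)) =
    inner (incidence R c) (axpy (- (u a)^-1) u (ind R (supp u))).
  by rewrite inner_axpyr uc mulr0 add0r.
rewrite /inner mulr_suml rpred_sum // => b _; rewrite -mulrA rpredM //.
  exact: incidence_int.
rewrite !ffunE in_supp.
have [->|ub] := eqVneq (u b) 0; first by rewrite mulr0 addr0 mul0r rpred0.
have /eqP := dual_unimodular regVN eu ub ua.
rewrite eqr_norm2 => /orP[]/eqP->.
  by rewrite mulNr mulVf // addNr mul0r rpred0.
by rewrite mulrN mulNr opprK mulVf // divff ?rpred1 // -mulr2n pnatr_eq0.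
Qed.

(** For the converse, a circuit meeting [S] in one element would have an odd inner product with its
    indicator. Hence each element of [S] lies in a cocircuit inside [S], and removing that cocircuit
    preserves evenness. *)
Lemma cocycleP S : cocycle F S <-> even_on S.
Proof.
split=> [/existsP[P /and3P[trivP /forall_inP cocP /eqP <-]] c cN|evS].
  rewrite inner_cover // mulr_suml rpred_sum // => D /cocP/even_cocircuit evD.
  exact: evD.
have [|P [trivP coverP cocP]] :=
    @disjoint_decomposition _ (fun D => cocircuit F D) even_on _ S evS.
  move=> {}S {}evS S0; have /set0Pn[a aS] := S0.
  have [[c cN [ca cS]]|[u [Vu ua uS]]] := circuit_or_cocycle regVN aS.
    exfalso; apply: (@half_notin_int (incidence R c a)).
      by rewrite (norm_incidence regVN).
    have := evS c cN; rewrite (@inner_single _ _ _ _ a) => [|b ba].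
      by rewrite [ind _ _ _]ffunE aS mulr1.
    rewrite [ind _ _ _]ffunE; case: (boolP (b \in S)) => bS; last by rewrite mulr0.
    rewrite incidence_out ?mul0r //; apply: contra ba => cb.
    by rewrite (cS b).
  have [|w [ew wa wu]] := elementary_through (a := a) linVo Vu.
    by rewrite ua oner_eq0.
  have cocw : cocircuit F (supp w) by apply/(cocircuitP regVN); exists w.
  have wS : supp w \subset S by apply: fintype.subset_trans uS.
  exists (supp w); split=> //.
    by apply/set0Pn; exists a; rewrite in_supp.
  move=> c cN; rewrite ind_setD // innerBr mulrBl rpredB ?evS //.
  exact: even_cocircuit.
apply/existsP; exists P; rewrite trivP coverP eqxx andbT /=.
exact/forall_inP.
Qed.

Lemma incidence_fst c a : c \in N -> (a \in c.1) = (incidence R c a == 1).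
Proof.
move=> /(rs_circuits regVN)[v _ ->]; rewrite incidence_sign inE.
by rewrite sgr_cp0.
Qed.

Lemma incidence_snd c a : c \in N -> (a \in c.2) = (incidence R c a == -1).
Proof.
move=> /(rs_circuits regVN)[v _ ->]; rewrite incidence_sign inE.
by rewrite sgr_cp0.
Qed.

Lemma positive_cocircuitP D :
  [exists d, positive_cocircuit N d && (D == supp_ss d)] <->
  cocircuit F D /\ orthocompl V (ind R D).
Proof.
split=> [/existsP[d /andP[/andP[/and3P[_ cocD /forall_inP orthD] d2] /eqP DE]]|].
  have dD : d.1 = D by rewrite DE /supp_ss (eqP d2) finset.setU0.
  rewrite -DE in cocD; split=> //.
  have [u eu Du] := (cocircuitP regVN D).1 cocD.
  have inD b : (b \in D) = (u b != 0) by rewrite Du in_supp.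
  have u_const a b : u a != 0 -> u b != 0 -> u a = u b.
    move=> ua ub; have [->//|ab] := eqVneq a b.
    have [c cN [ca cb cD]] := circuit_pair regVN eu ua ub ab.
    have : `|incidence R c a| == `|incidence R c b|.
      by rewrite !(norm_incidence regVN).
    rewrite eqr_norm2 => /orP[/eqP iab _|/eqP-> /eqP]; last first.
      rewrite mulNr addrC subr_eq0 => /eqP/mulfI-> //.
      by rewrite -normr_eq0 (norm_incidence regVN) // oner_eq0.
    have inc_ab e : e \in D -> e \in supp_ss c -> incidence R c e = incidence R c a.
      by rewrite inD => ue ce; case: (cD e ue ce) => ->.
    have aD : a \in D by rewrite inD.
    have c12 e : e \in D -> e \in c.1 -> a \in c.1.
      move=> eD e1; rewrite incidence_fst // -(inc_ab e) -?incidence_fst //.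
      by rewrite inE e1.
    have c22 e : e \in D -> e \in c.2 -> a \in c.2.
      move=> eD e2; rewrite incidence_snd // -(inc_ab e) -?incidence_snd //.
      by rewrite inE e2 orbT.
    have meets (T : {set A}) : (forall e, e \in D -> e \in T -> a \in T) ->
        (T :&: D == finset.set0)%SET = (a \notin T).
      move=> TD; apply/eqP/idP => [TD0|aT].
        by apply: contraT => /negbNE aT; move/setP/(_ a): TD0; rewrite !inE aT aD.
      apply/setP => e; rewrite !inE; apply/negP => /andP[eT eD].
      by rewrite (TD e) in aT.
    have := orthD c cN; rewrite /orthogonal_ss dD (eqP d2) !finset.setI0.
    rewrite finset.setU0 finset.set0U !meets // !incidence_fst // !incidence_snd //.
    have := norm_incidence regVN cN ca; move/eqP; rewrite eqr_norml ler01 andbT.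
    have oneN : (1 == -1 :> R) = false by rewrite -addr_eq0 -mulr2n pnatr_eq0.
    by case/orP => /eqP->; rewrite !eqxx 1?[-1 == 1]eq_sym oneN.
  have [u0 Vu _] := eu; have [a] := supp_neq0 u0; rewrite in_supp => ua.
  have -> : ind R D = axpy (u a)^-1 u 0.
    apply/ffunP => b; rewrite !ffunE addr0 inD.
    have [->|ub] := eqVneq (u b) 0; first by rewrite mulr0.
    by rewrite (u_const a b) // mulVf.
  by apply: linVo.2 => //; exact: linVo.1.
move=> [cocD VD]; apply/existsP; exists (D, finset.set0).
rewrite /positive_cocircuit /signed_cocircuit /supp_ss /= finset.setU0 !eqxx.
rewrite !andbT cocD /=; apply/andP; split.
  by apply/pred0P => a; rewrite /= inE andbF.
apply/forall_inP => c cN; rewrite /orthogonal_ss /= !finset.setI0.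
rewrite finset.setU0 finset.set0U.
have cD0 := VD _ (circuit_space regVN cN); rewrite inner_ind in cD0.
have iE e : incidence R c e = (e \in c.1)%:R - (e \in c.2)%:R by rewrite ffunE.
have disj e : e \in c.1 -> e \in c.2 -> False.
  rewrite incidence_fst // incidence_snd // => /eqP->.
  by rewrite -addr_eq0 -mulr2n pnatr_eq0.
have meets (T T' : {set A}) (s : R) :
    (forall e, (e \in T)%:R - (e \in T')%:R = s * incidence R c e) ->
    (forall e, e \in T -> e \in T' -> False) ->
    (T :&: D == finset.set0)%SET -> (T' :&: D == finset.set0)%SET.
  move=> sT disjT /eqP/setP TD0; apply: contraT => /set0Pn[a].
  rewrite inE => /andP[aT' aD].
  have : \sum_(e in D) ((e \in T)%:R - (e \in T')%:R) = 0 :> R.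
    by under eq_bigr do rewrite sT; rewrite -mulr_sumr cD0 mulr0.
  move/eqP; under eq_bigr => e eD.
    have := TD0 e; rewrite !inE eD andbT => ->; rewrite sub0r; over.
  rewrite sumrN oppr_eq0 psumr_eq0 // => /allP/(_ a (mem_index_enum a)).
  by rewrite aD aT' oner_eq0.
apply/eqP; apply/idP/idP; first by apply: (meets _ _ 1) => // e; rewrite iE mul1r.
apply: (meets _ _ (-1)) => [e|e e2 e1]; last exact: (disj e).
by rewrite iE mulN1r opprB.
Qed.

Lemma positive_cocycleP P : positive_cocycle N P <-> orthocompl V (ind R P).
Proof.
split=> [/existsP[Q /and3P[trivQ /forall_inP posQ /eqP <-]] v Vv|VP].
  rewrite inner_cover // big1 // => D /posQ/positive_cocircuitP[_ VD].
  exact: VD.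
have [|Q [trivQ coverQ posQ]] := @disjoint_decomposition _
    (fun D => cocircuit F D /\ orthocompl V (ind R D))
    (fun S => orthocompl V (ind R S)) _ P VP.
  move=> S VS S0.
  have indS0 : ind R S != 0.
    apply: contra S0 => /eqP S0; apply/eqP/setP => a; rewrite inE.
    by move/ffunP/(_ a)/eqP: S0; rewrite !ffunE pnatr_eq0 eqb0 => /negPf.
  have [|w [ew w_ge0 wS]] := nonneg_elementary linVo VS indS0.
    by move=> a; rewrite ffunE ler0n.
  rewrite supp_ind in wS; have [w0 Vw _] := ew.
  have [a] := supp_neq0 w0; rewrite in_supp => wa.
  have indw : ind R (supp w) = axpy (w a)^-1 w 0.
    apply/ffunP => b; rewrite !ffunE addr0 in_supp.
    have [->|wb] := eqVneq (w b) 0; first by rewrite mulr0.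
    have := dual_unimodular regVN ew wa wb; rewrite !ger0_norm // => ->.
    by rewrite mulVf.
  have Vindw : orthocompl V (ind R (supp w)).
    by rewrite indw; apply: linVo.2 => //; exact: linVo.1.
  exists (supp w); split=> //.
  - by split=> //; apply/(cocircuitP regVN); exists w.
  - by apply/set0Pn; exists a; rewrite in_supp.
  - by move=> v Vv; rewrite ind_setD // innerBr VS // Vindw // subrr.
apply/existsP; exists Q; rewrite trivQ coverQ eqxx andbT /=.
by apply/forall_inP => D /posQ/positive_cocircuitP.
Qed.

Lemma acyclicP :
  acyclic N <-> exists2 u, orthocompl V u & forall a, 0 < u a.
Proof.
split=> [/forall_inP acN|[u Vu u_gt0]]; last first.
  apply/forall_inP => c cN; apply/negP => /eqP c2.
  have [a ca] := circuit_neq0 regVN cN.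
  have := Vu _ (circuit_space regVN cN); apply/eqP; rewrite gt_eqF //.
  have inc b : incidence R c b = (b \in c.1)%:R by rewrite ffunE c2 inE subr0.
  apply: (@inner_gt0 _ _ _ _ a) => [b|]; first by rewrite inc mulr_ge0 // ltW.
  by move: ca; rewrite /supp_ss c2 finset.setU0 inc => ->; rewrite mul1r.
have ex_u a : exists u, [/\ orthocompl V u, forall b, 0 <= u b & 0 < u a].
  have aG : a \notin [set~ a]%SET by rewrite !inE eqxx.
  have aX : a \notin finset.set0 by rewrite inE.
  have GX : [disjoint [set~ a]%SET & finset.set0].
    by apply/pred0P => b; rewrite /= !inE andbF.
  have outG b : b = a \/ b \in [set~ a]%SET.
    by rewrite !inE; case: eqVneq => [|_]; [left|right].
  have [[v [Vv va v_ge0 _]]|[u [Vu ua u_ge0 _]]] :=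
      farkas (rs_fredholm regVN) aG aX GX; last first.
    exists u; rewrite ua; split=> // b.
    by case: (outG b) => [->|/u_ge0//]; rewrite ua.
  have v_ge0' b : 0 <= v b by case: (outG b) => [->|/v_ge0//]; rewrite va.
  have v0 : v != 0.
    by apply: contra_eq_neq va => ->; rewrite ffunE eq_sym oner_eq0.
  have [w [ew w_ge0 _]] := nonneg_elementary linV Vv v0 v_ge0'.
  have /acN/negP[] : sign_ss w \in N by apply/(rs_circuits regVN); exists w.
  by apply/eqP/setP => b; rewrite !inE ltNge w_ge0.
have [f fP] := choice ex_u.
exists [ffun b => \sum_a f a b] => [v Vv|b].
  rewrite /inner; under eq_bigr do rewrite ffunE mulr_sumr.
  rewrite exchange_big big1 //= => a _.
  by have [/(_ v Vv)] := fP a.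
rewrite ffunE (bigD1 b) //=; have [_ _ fb] := fP b.
by rewrite ltr_wpDr // sumr_ge0 // => a _; have [_ ->] := fP a.
Qed.

(* Move inside the box along a vector of the orthogonal complement supported on
   the fractional coordinates; if there is none, some circuit has exactly one
   fractional coordinate [a], which makes [y a] an integer. *)
Lemma integral_point y : (forall a, 0 <= y a <= 1) ->
  (forall c, c \in N -> inner (incidence R c) y \is a Num.int) ->
  exists S, orthocompl V (ind R S - y).
Proof.
pose frac (z : {ffun A -> R}) := [set a | 0 < z a < 1]%SET.
have [n] := ubnP #|frac y|; elim: n y => // n IH y leF y01 yint.
have [F0|[a aF]] := set_0Vmem (frac y).
  exists [set a | y a == 1]%SET => v Vv; rewrite [X in inner _ X](_ : _ = 0) ?inner0r //.
  apply/ffunP => a; rewrite !ffunE !inE.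
  have [->|ya1] := eqVneq (y a) 1; first by rewrite subrr.
  have [->|ya0] := eqVneq (y a) 0; first by rewrite subrr.
  have /andP[ya_ge0 ya_le1] := y01 a.
  have : a \in frac y by rewrite inE !lt_def ya0 ya_ge0 eq_sym ya1.
  by rewrite F0 inE.
have [[c cN [ca cF]]|[u [Vu ua uF]]] := circuit_or_cocycle regVN aF.
  exfalso; have := yint c cN; rewrite /inner (bigD1 a) //= => cy.
  have : incidence R c a * y a \is a Num.int.
    rewrite -[X in X \is a _](addrK (\sum_(b | b != a) incidence R c b * y b)).
    rewrite rpredB // rpred_sum // => b ba.
    have [cb|cb] := boolP (b \in supp_ss c); last first.
      by rewrite incidence_out // mul0r rpred0.
    rewrite rpredM ?incidence_int //.
    have : b \notin frac y by apply: contra ba => bF; rewrite (cF b).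
    have /andP[yb_ge0 yb_le1] := y01 b.
    rewrite inE !lt_def yb_ge0 yb_le1 !andbT negb_and !negbK.
    by case/orP => /eqP; [move->|move<-]; rewrite ?rpred0 ?rpred1.
  move/norm_intr_ge1; rewrite inE in aF; have /andP[ya_gt0 ya_lt1] := aF.
  rewrite -normr_eq0 normrM (norm_incidence regVN) // mul1r.
  by rewrite gtr0_norm // gt_eqF // leNgt ya_lt1 => /(_ isT).
have inF b : u b != 0 -> 0 < y b < 1.
  by rewrite -in_supp => /(fintype.subsetP uF); rewrite inE.
pose step b := (if 0 < u b then 1 - y b else - y b) / u b.
have ua0 : u a != 0 by rewrite ua oner_eq0.
case: (@arg_minP _ _ _ a (fun b => u b != 0) step ua0) => i ui mini.
have step_gt0 : 0 < step i.
  rewrite /step; have /andP[yi_gt0 yi_lt1] := inF _ ui.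
  case: ifP => [ui0|]; first by rewrite divr_gt0 ?subr_gt0.
  move/negbT; rewrite -leNgt le_eqVlt (negPf ui) /= => ui0.
  by rewrite -mulrNN -invrN divr_gt0 ?opprK ?oppr_gt0.
pose z := axpy (step i) u y.
have z01 b : 0 <= z b <= 1.
  rewrite ffunE; have [->|ub] := eqVneq (u b) 0; first by rewrite mulr0 add0r.
  have := mini b ub; have /andP[yb_gt0 yb_lt1] := inF _ ub.
  rewrite {2}/step; case: (ltP 0 (u b)) => ub0.
    rewrite ler_pdivlMr // lerBrDr => ->; rewrite andbT.
    by apply: addr_ge0; [apply: mulr_ge0|]; apply: ltW.
  have {}ub0 : u b < 0 by rewrite lt_neqAle ub.
  rewrite ler_ndivlMr // => h; apply/andP; split.
    by rewrite -(lerD2r (- y b)) addrK sub0r.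
  apply: (@le_trans _ _ (y b)); last exact: ltW.
  by rewrite gerDr; apply: mulr_ge0_le0; apply: ltW.
have zi : i \notin frac z.
  rewrite inE ffunE /step; case: ifP => _.
    by rewrite divfK // subrK ltxx andbF.
  by rewrite divfK // addNr ltxx.
have fracz : frac z \proper frac y.
  rewrite properE; apply/andP; split.
    apply/fintype.subsetP => b; rewrite !inE.
    by have [ub|/inF//] := eqVneq (u b) 0; rewrite ffunE ub mulr0 add0r.
  by apply/fintype.subsetPn; exists i; rewrite // inE inF.
have Vzy c : c \in N -> inner (incidence R c) z = inner (incidence R c) y.
  move=> cN; rewrite inner_axpyr Vu ?mulr0 ?add0r //.
  exact: (circuit_space regVN cN).
have [||c cN|S VS] := IH z; first 1 last.
- exact: z01.
- by rewrite Vzy ?yint.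
- exists S => v Vv; rewrite -(VS v Vv) !innerBr inner_axpyr (Vu v Vv).
  by rewrite mulr0 add0r.
- by rewrite ltnS in leF; apply: leq_trans (proper_card fracz) leF.
Qed.

End Cocycles.

(** * Reorientations and classes *)

Section Reorientation.
Variables (R : realType) (A : finType).
Implicit Types (u v w x y : {ffun A -> R}) (V : {ffun A -> R} -> Prop).
Implicit Types (a b e : A) (X B D I J S T P : {set A}).
Implicit Types (c d : signed_set A) (N : {set signed_set A}).

Definition flip S v : {ffun A -> R} := [ffun a => (-1) ^+ (a \in S) * v a].

Lemma flipK S : involutive (flip S).
Proof. by move=> v; apply/ffunP => a; rewrite !ffunE signrMK. Qed.

Lemma inner_flip S u v : inner (flip S u) (flip S v) = inner u v.
Proof.
by apply: eq_bigr => a _; rewrite !ffunE mulrACA -signr_addb addbb mul1r.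
Qed.

Lemma supp_flip S v : supp (flip S v) = supp v.
Proof. by apply/setP => a; rewrite !in_supp ffunE mulf_eq0 signr_eq0. Qed.

Lemma flip_axpy S k v w : flip S (axpy k v w) = axpy k (flip S v) (flip S w).
Proof. by apply/ffunP => a; rewrite !ffunE mulrDr mulrCA. Qed.

Lemma flip0 S : flip S 0 = 0.
Proof. by apply/ffunP => a; rewrite !ffunE mulr0. Qed.

Lemma sign_flip S v : sign_ss (flip S v) = reorient_ss S (sign_ss v).
Proof.
rewrite /sign_ss /reorient_ss /=; congr pair; apply/setP => a; rewrite !inE ffunE;
  by case: (a \in S); rewrite ?expr1 ?expr0 ?mulN1r ?mul1r ?oppr_gt0 ?oppr_lt0
     ?andbF ?andbT ?orbF.
Qed.

Definition reoriented V S v := V (flip S v).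

Lemma orthocompl_reoriented V S u :
  orthocompl (reoriented V S) u <-> orthocompl V (flip S u).
Proof.
split=> Vu v Vv.
  by rewrite -(inner_flip S) flipK; apply: Vu; rewrite /reoriented flipK.
by rewrite -(inner_flip S); exact: Vu.
Qed.

Lemma elementary_reoriented V S v :
  elementary (reoriented V S) v <-> elementary V (flip S v).
Proof.
have flip_neq0 w : w != 0 -> flip S w != 0.
  by apply: contra_neq => w0; rewrite -(flipK S w) w0 flip0.
split=> -[v0 Vv minv]; split=> //.
- exact: flip_neq0.
- move=> w w0 Vw; rewrite supp_flip -(supp_flip S w); apply: minv.
    exact: flip_neq0.
  by rewrite /reoriented flipK.
- by apply: contra_neq v0 => ->; rewrite flip0.
- move=> w w0 Vw; rewrite -(supp_flip S w) -(supp_flip S v); apply: minv => //.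
  exact: flip_neq0.
Qed.

Lemma regular_reoriented V N S : regular_system V N ->
  regular_system (reoriented V S) (reorient S N).
Proof.
move=> [[V0 VD] frV uniV circV]; split.
- split=> [|k v w Vv Vw]; first by rewrite /reoriented flip0.
  by rewrite /reoriented flip_axpy; exact: VD.
- move=> X a aX.
  have scaled (W : {ffun A -> R} -> Prop) v : linear_space W -> W v ->
      W (axpy ((-1) ^+ (a \in S)) v 0).
    by move=> [W0 WD] Wv; exact: WD.
  have valE v b : v b = 0 -> flip S (axpy ((-1) ^+ (a \in S)) v 0) b = 0.
    by move=> vb; rewrite !ffunE vb mulr0 addr0 mulr0.
  have valaE v : v a = 1 -> flip S (axpy ((-1) ^+ (a \in S)) v 0) a = 1.
    by move=> va; rewrite !ffunE addr0 signrMK.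
  have [[v [Vv va v0]]|[u [Vu ua u0]]] := frV X a aX; [left|right].
    exists (flip S (axpy ((-1) ^+ (a \in S)) v 0)); rewrite valaE //.
    split=> // [|b bX ba]; last by rewrite valE // v0.
    by rewrite /reoriented flipK; exact: scaled.
  exists (flip S (axpy ((-1) ^+ (a \in S)) u 0)); rewrite valaE //.
  split=> // [|b bX]; last by rewrite valE // u0.
  apply/orthocompl_reoriented; rewrite flipK.
  by apply: (scaled (orthocompl V)) => //; exact: linear_orthocompl.
- move=> v a b /elementary_reoriented ev va vb.
  have := uniV _ a b ev; rewrite -!in_supp !supp_flip !in_supp => /(_ va vb).
  by rewrite !ffunE !normrMsign.
- move=> c; split=> [/imsetP[c0 /circV[v ev ->] ->]|[v ev ->]].
    exists (flip S v); last by rewrite sign_flip.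
    by apply/elementary_reoriented; rewrite flipK.
  rewrite -(flipK S v) sign_flip; apply: imset_f; apply/circV.
  by exists (flip S v) => //; apply/elementary_reoriented.
Qed.

Lemma flip_ind S P : flip S (ind R P) = ind R (symdiff S P) - ind R S.
Proof.
apply/ffunP => a; rewrite !ffunE !inE.
by case: (a \in S); case: (a \in P);
  rewrite ?expr0 ?expr1 ?mulr1 ?mulr0 ?subr0 ?sub0r ?subrr.
Qed.

Lemma symdiffK S : involutive (symdiff S).
Proof.
by move=> T; apply/setP => a; rewrite !inE; case: (a \in S); case: (a \in T).
Qed.

Section Classes.
Variables (V : {ffun A -> R} -> Prop) (N : {set signed_set A}).
Hypothesis regVN : regular_system V N.
Local Notation F := (underlying_circuits N).

Lemma pos_equivP S T : pos_equiv N S T <-> orthocompl V (ind R T - ind R S).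
Proof.
have posP P : positive_cocycle (reorient S N) P <->
    orthocompl V (ind R (symdiff S P) - ind R S).
  split=> [/(positive_cocycleP (regular_reoriented S regVN))|].
    by move/orthocompl_reoriented; rewrite flip_ind.
  move=> VP; apply/(positive_cocycleP (regular_reoriented S regVN)).
  by apply/orthocompl_reoriented; rewrite flip_ind.
split=> [/existsP[P /andP[/posP + /eqP->]]//|VT].
by apply/existsP; exists (symdiff S T); rewrite symdiffK eqxx andbT; apply/posP;
  rewrite symdiffK.
Qed.

Lemma pos_class_eq S T :
  pos_class N S = pos_class N T <-> orthocompl V (ind R T - ind R S).
Proof.
split=> [ST|VST].
  apply/pos_equivP; have : T \in pos_class N S.
    rewrite ST inE; apply/pos_equivP => v Vv.
    by rewrite subrr inner0r.
  by rewrite inE.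
apply/setP => U; rewrite !inE; apply/idP/idP => /pos_equivP VU;
  apply/pos_equivP => v Vv; have := VST v Vv; have := VU v Vv; rewrite !innerBr.
  by move=> /subr0_eq-> /subr0_eq->; rewrite subrr.
by move=> /subr0_eq-> /subr0_eq->; rewrite subrr.
Qed.

Definition half_ind S : {ffun A -> R} := [ffun a => (a \in S)%:R / 2].

Lemma inner_half v S : inner v (half_ind S) = inner v (ind R S) / 2.
Proof.
by rewrite /inner mulr_suml; apply: eq_bigr => a _; rewrite !ffunE mulrA.
Qed.

Lemma alpha_eq x y :
  (forall c, c \in N -> inner (incidence R c) x \is a Num.int) ->
  (forall c, c \in N -> inner (incidence R c) y \is a Num.int) ->
  alpha N x = alpha N y <->
    forall c, c \in N -> inner (incidence R c) x = inner (incidence R c) y.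
Proof.
move=> xint yint; split=> [/ffunP xy c cN|xy].
  have := xy (exist _ c cN); rewrite !ffunE /= => fxy.
  by rewrite -(floorK (xint c cN)) fxy floorK // yint.
by apply/ffunP => c; rewrite !ffunE xy // (valP c).
Qed.

Lemma alpha_half_eq S T : cocycle F S -> cocycle F T ->
  alpha N (half_ind S) = alpha N (half_ind T) <-> pos_class N S = pos_class N T.
Proof.
move=> /(cocycleP regVN) evS /(cocycleP regVN) evT.
rewrite alpha_eq; [|by move=> c cN; rewrite inner_half evS..|].
  rewrite pos_class_eq (orthocompl_circuits regVN).
  have half_inj : injective (fun z : R => z / 2).
    by apply: mulIf; rewrite invr_eq0 pnatr_eq0.
  split=> ST c cN; have := ST c cN; rewrite !inner_half innerBr.
    by move/half_inj->; rewrite subrr.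
  by move/subr0_eq->.
by move=> c cN; rewrite inner_half evT.
Qed.

Lemma half_ind_Pi S : cocycle F S -> Pi_ge N (half_ind S).
Proof.
move=> /(cocycleP regVN) evS; split=> [a|c cN]; last by rewrite inner_half evS.
rewrite ffunE; case: (a \in S); last by rewrite mul0r lexx invr_ge0 ler0n.
by rewrite mul1r lexx invr_ge0 ler0n.
Qed.

Lemma round_Pi x : Pi_ge N x ->
  exists S, [/\ cocycle F S, alpha N (half_ind S) = alpha N x
    & orthocompl V (ind R S - axpy 2 x 0)].
Proof.
move=> [x01 xint].
have y_inner c : inner (incidence R c) (axpy 2 x 0) = 2 * inner (incidence R c) x.
  by rewrite inner_axpyr inner0r addr0.
have [|c cN|S VS] := @integral_point _ _ _ _ regVN (axpy 2 x 0).
- move=> a; have /andP[x0 x1] := x01 a; rewrite !ffunE addr0 mulr_ge0 ?ler0n //=.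
  by rewrite mulrC -ler_pdivlMr ?ltr0n // mul1r.
- by rewrite y_inner rpredM ?xint // natr_int.
have half_x c : c \in N ->
    inner (incidence R c) (half_ind S) = inner (incidence R c) x.
  move=> cN; have := VS _ (circuit_space regVN cN).
  rewrite innerBr inner_half y_inner => /subr0_eq->.
  by rewrite mulrC mulKf // pnatr_eq0.
exists S; split=> //.
  by apply/(cocycleP regVN) => c cN; rewrite -inner_half half_x ?xint.
by apply/alpha_eq => // c cN; rewrite ?half_x // xint.
Qed.

Lemma Omega_geE : Omega_ge R N =
  ((alpha N \o half_ind) @` [set` [set S | cocycle F S]%SET])%classic.
Proof.
apply/seteqP; split=> t [z].
  move=> /round_Pi[S [cocS <- _]] <-; exists S => //=.
  by rewrite inE.
by rewrite /= inE => cocz <-; exists (half_ind z) => //; exact: half_ind_Pi.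
Qed.

Lemma acyclic_reorientP S : acyclic (reorient S N) <->
  exists2 u, orthocompl V (flip S u) & forall a, 0 < u a.
Proof.
rewrite (acyclicP (regular_reoriented S regVN)).
by split=> -[u Vu u0]; exists u => //; apply/orthocompl_reoriented.
Qed.

Lemma acyclic_push S : cocycle F S -> acyclic (reorient S N) ->
  exists2 x : {ffun A -> R}, Pi_gt N x & alpha N x = alpha N (half_ind S).
Proof.
move=> /(cocycleP regVN) evS /acyclic_reorientP[u Vu u0].
pose k := (1 + \sum_a u a)^-1.
have sum_ge0 : 0 <= \sum_a u a by rewrite sumr_ge0 // => a _; exact: ltW.
have k1_gt0 : 0 < 1 + \sum_a u a by rewrite ltr_wpDr.
have k_gt0 : 0 < k by rewrite invr_gt0.
have ku_lt1 a : k * u a < 1.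
  rewrite mulrC ltr_pdivrMr // mul1r (bigD1 a) //=.
  rewrite addrCA ltrDl ltr_wpDr // sumr_ge0 // => b _; exact: ltW.
pose x := axpy (k / 2) (flip S u) (half_ind S).
have x_inner c : c \in N ->
    inner (incidence R c) x = inner (incidence R c) (half_ind S).
  move=> cN; rewrite inner_axpyr Vu ?mulr0 ?add0r //.
  exact: (circuit_space regVN cN).
have half_int c : c \in N -> inner (incidence R c) (half_ind S) \is a Num.int.
  by move=> cN; rewrite inner_half evS.
exists x; last by apply/alpha_eq => // c cN; rewrite x_inner // half_int.
split=> [a|c cN]; last by rewrite x_inner // half_int.
have -> : x a = (if a \in S then 1 - k * u a else k * u a) / 2.
  rewrite !ffunE; case: (a \in S); rewrite ?expr1 ?expr0 ?mulN1r ?mul1r.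
    by rewrite mulrN mulrBl addrC mul1r mulrAC.
  by rewrite mul0r addr0 mulrAC.
have ku_gt0 : 0 < k * u a by rewrite mulr_gt0.
have two_gt0 : (0 : R) < 2 by rewrite ltr0n.
rewrite ltr_pdivlMr // mul0r ltr_pdivrMr // mulVf ?gt_eqF //.
by case: ifP => _; rewrite ?subr_gt0 ?gtrBl ku_lt1 ku_gt0.
Qed.

Lemma Omega_gtE : Omega_gt R N =
  ((alpha N \o half_ind) @`
    [set` [set S | cocycle F S & acyclic (reorient S N)]%SET])%classic.
Proof.
apply/seteqP; split=> t [z].
  move=> Pz <-; have [z01 zint] := Pz.
  have Pz' : Pi_ge N z.
    by split=> // a; have /andP[/ltW-> /ltW->] := z01 a.
  have [S [cocS aS VS]] := round_Pi Pz'; exists S => //=.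
  rewrite inE cocS; apply/acyclic_reorientP.
  exists (flip S (axpy 2 z (- ind R S))).
    rewrite flipK => v Vv; have := VS v Vv; rewrite innerBr => /subr0_eq vS.
    rewrite -[RHS](subrr (inner v (ind R S))) {1}vS -innerBr; congr inner.
    by apply/ffunP => a; rewrite !ffunE addr0.
  move=> a; have /andP[z0 z1] := z01 a; rewrite !ffunE.
  have z2 : 2 * z a < 1 by rewrite mulrC -ltr_pdivlMr ?ltr0n // mul1r.
  case: (a \in S); rewrite ?expr1 ?expr0 ?mulN1r ?mul1r.
    by rewrite opprD opprK addrC subr_gt0.
  by rewrite oppr0 addr0 mulr_gt0 // ltr0n.
rewrite /= inE => /andP[cocz acz] <-.
by have [x Px <-] := acyclic_push cocz acz; exists x.
Qed.

End Classes.
End Reorientation.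

Lemma card_image_imset (T V : finType) (U : Type) (f : T -> U) (g : T -> V)
    (D : {set T}) :
  {in D &, forall x y, f x = f y <-> g x = g y} ->
  (f @` [set` D] #= `I_#|g @: D|)%classic%card.
Proof.
move=> fg; pose k x := index (g x) (enum (g @: D)%SET).
pose h u : nat := if pselect (exists2 x, x \in D & f x = u) is left ex
  then k (s2val (cid2 ex)) else 0.
have hE x : x \in D -> h (f x) = k x.
  move=> xD; rewrite /h; case: pselect => [ex|[]]; last by exists x.
  by case: (cid2 ex) => y yD /= /(fg _ _ yD xD) gyx; rewrite /k gyx.
have g_in x : x \in D -> g x \in enum (g @: D)%SET.
  by move=> xD; rewrite mem_enum imset_f.
have hinj : {in (f @` [set` D])%classic &, injective h}.
  move=> u u'; rewrite !inE => -[x /= xD <-] [y /= yD <-]; rewrite !hE //.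
  by move=> kxy; apply/(fg _ _ xD yD);
    exact: (index_inj (g x) (g_in _ xD) (g_in _ yD) kxy).
have <- : (h @` (f @` [set` D]) = `I_#|(g @: D)%SET|)%classic.
  apply/seteqP; split=> n /=.
    move=> [_ [x /= xD <-] <-]; rewrite hE // /k cardE index_mem.
    exact: g_in.
  rewrite cardE => nlt.
  case E: (enum (g @: D)%SET) => [|v0 s]; first by rewrite E in nlt.
  have : nth v0 (enum (g @: D)%SET) n \in enum (g @: D)%SET by apply: mem_nth.
  rewrite mem_enum => /imsetP[x xD gx]; exists (f x); first by exists x.
  by rewrite hE // /k -gx index_uniq // enum_uniq.
by rewrite card_eq_sym; exact: inj_card_eq.
Qed.

Lemma regular_systemP (R : realType) (A : finType) (N : {set signed_set A}) :
  regular R N -> exists V : {ffun A -> R} -> Prop, regular_system V N.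
Proof.
move=> [m [M [tuM repM]]]; exists (dependency M); split.
- exact: linear_dependency.
- exact: fredholm_dependency.
- move=> v a b; exact: tu_elementary.
- move=> c; split=> [/repM[v /minimal_dependencyE ev ->]|[v ev ->]].
    by exists v.
  by apply/repM; exists v => //; apply/minimal_dependencyE.
Qed.

Local Open Scope classical_set_scope.
Local Open Scope card_scope.

Theorem theorem9p4 (R : realType) (A : finType) (N : {set signed_set A})
    (om_N : oriented_matroid N) (regular_N : regular R N) :
  Omega_ge R N #= `I_#|cocycle_classes N| /\
  Omega_gt R N #= `I_#|acyclic_cocycle_classes N|.
Proof.
have [V regVN] := regular_systemP regular_N.
rewrite (Omega_geE regVN) (Omega_gtE regVN).
split; apply: card_image_imset => S T; rewrite !inE.
  exact: (alpha_half_eq regVN).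
by move=> /andP[cocS _] /andP[cocT _]; exact: (alpha_half_eq regVN).
Qed.
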